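(* Let $M\in\mathbb{R}^{n\times n}$ and $M'\in\mathbb{R}^{n'\times n'}$ be irreducible nonnegative matrices such that $M\mathbf{1}_n=\rho\mathbf{1}_n$ and $M'\mathbf{1}_{n'}=\rho'\mathbf{1}_{n'}$. Let $$\mathrm{J}_M=\begin{bmatrix}\rho & \mathbf{0}^T\\ \mathbf{0} & D+N\end{bmatrix},\qquad \mathrm{J}_{M'}=\begin{bmatrix}\rho' & \mathbf{0}^T\\ \mathbf{0} & D'+N'\end{bmatrix}$$ be the Jordan canonical forms of $M$ and $M'$, where $D$ and $D'$ are diagonal and $N$ and $N'$ are nilpotent. Then the Jordan canonical form of the matrix $M\otimes\mathbb{J}_{n'}+\mathbb{J}_n\otimes M'$ is $$\begin{bmatrix} n\rho'+n'\rho & \mathbf{0}^T & \mathbf{0}^T & \mathbf{0}^T\\ \mathbf{0} & nD'+N' & O & O\\ \mathbf{0} & O & n'D+N & O\\ \mathbf{0} & O & O & O\end{bmatrix}.$$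
   Context: $\mathbf{1}_n$ is the all-ones vector of length $n$, $\mathbb{J}_n$ is the $n\times n$ all-ones matrix, $O$ denotes zero matrices, $\mathbf 0$ zero vectors, and $\otimes$ is the Kronecker product. $\mathrm{J}_A$ denotes the Jordan canonical form of $A$ (over $\mathbb{C}$, upper triangular, determined up to the order of the Jordan blocks). Any Jordan matrix is written as $D+N$ with $D$ its diagonal part and $N$ its nilpotent (superdiagonal) part. The block sizes in the displayed $nn'\times nn'$ matrix are $1$, $n'-1$, $n-1$, $(n-1)(n'-1)$. *)

(* Defs.v *)
From mathcomp Require Import all_boot all_order all_fingroup all_algebra.
From mathcomp Require Import reals complex mxtens.

Set Implicit Arguments.
Unset Strict Implicit.
Unset Printing Implicit Defensive.

Import GRing.Theory Num.Theory.

Local Open Scope ring_scope.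

(* The 1 x 1 zero matrix is irreducible under this convention. *)
Definition reducible_mx (R : pzRingType) n (A : 'M[R]_n) : Prop :=
  exists (s : 'S_n) (k : nat), (0 < k < n)%N /\
    forall i j : 'I_n, (k <= i)%N -> (j < k)%N ->
      (perm_mx s *m A *m (perm_mx s)^T) i j = 0.

Definition irreducible_mx (R : pzRingType) n (A : 'M[R]_n) : Prop :=
  ~ reducible_mx A.

Definition nilpotent_mx (R : pzRingType) n (A : 'M[R]_n) : Prop :=
  exists k : nat, A ^+ k = 0.

Definition jordan_block (R : pzRingType) (s : nat) (a : R) : 'M[R]_s :=
  \matrix_(i, j) (a *+ (i == j) + (i.+1 == j :> nat)%:R).

Definition jordan_mx (R : pzRingType) n (J : 'M[R]_n) : Prop :=
  exists (k : nat) (s : 'I_k -> nat) (a : 'I_k -> R)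
         (e : (\sum_(i < k) s i)%N = n),
    (forall i, 0 < s i)%N /\
    J = castmx (e, e) (\mxdiag_(i < k) jordan_block (s i) (a i)).

(* The form is unique only up to the order of its blocks, hence a relation. *)
Definition jordan_form_of (F : fieldType) n (A J : 'M[F]_n) : Prop :=
  jordan_mx J /\ similar_in unitmx A J.

Definition dsum_mx (R : pzRingType) m n (A : 'M[R]_m) (B : 'M[R]_n) :
  'M[R]_(m + n) := block_mx A 0 0 B.

Lemma tens_dim n n' : (1 + (n' + (n + n * n')))%N = (n.+1 * n'.+1)%N.
Proof. by rewrite mulSn mulnS add1n addSn. Qed.

(* Main.v *)
Require Import Defs.
From mathcomp Require Import all_boot all_order all_fingroup all_algebra.
From mathcomp Require Import boolp reals complex mxtens.

(** Write [J] for all-ones matrices and [1] for the all-ones column, and let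
    [A = M (x) J + J (x) M'].  The idea is to exhibit a basis in which [A] is
    the displayed matrix.

    Since [M] is irreducible and nonnegative, the eigenspace of its row sum
    [rho] is the line spanned by [1]: the set of indices at which a real
    eigenvector is maximal cannot be left.  Hence the first vector of a Jordan basis
    of [M] is a multiple of [1], and the remaining ones form a matrix [Y] with
    [M Y = Y (D + N)]; rescaling the columns of [Y] by powers of a nonzero [c]
    turns [c (D + N)] into [c D + N] ([perron_jordan_basis]).  The same holds
    for [M'] with some [Y'].

    Because [J] sends every vector to a multiple of [1], the subspaces [1 (x) y']
    and [y (x) 1] are invariant modulo the line of [1 (x) 1], and there [A] acts as
    [n M'] and [n' M]; the vectors [x (x) x'] with [x] and [x'] both of
    coordinate sum zero are killed by [A], and they supply the zero block.
    On the line itself [A] acts as [l = n rho' + n' rho].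

    What remains is the coupling to the line, which has coefficients
    [rho 1^T Y'] and [rho' 1^T Y].  It is removed by replacing [1 (x) Y'] with
    [1 (x) Y' + (1 (x) 1) u'], which requires
    [u' (n D' + N') = l u' + rho 1^T Y'] ([splitting_row]).  If [rho = 0] then
    [u' = 0] works.  Otherwise [l > n rho'] exceeds the spectral radius of
    [n M'], so [n D' + N' - l] is invertible ([deflated_unitmx]).  The other
    block is symmetric.  The new family is independent because summing over
    either tensor factor recovers the coordinates one group at a time
    ([tensor_basis_inj]).

    That the resulting matrix is again a Jordan matrix is checked through an
    entrywise description of Jordan matrices ([jordan_mxP]), which, unlike the
    description by a list of blocks, passes to direct sums and to their
    summands with no reindexing. *)

Set Implicit Arguments.
Unset Strict Implicit.
Unset Printing Implicit Defensive.

Import Order.TTheory GRing.Theory Num.Theory.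

Local Open Scope ring_scope.
Local Open Scope complex_scope.

(** * Jordan matrices, entry by entry *)

Definition jordan_entries (R : pzRingType) n (J : 'M[R]_n) : Prop :=
  forall i j : 'I_n,
    (j != i :> nat -> j != i.+1 :> nat -> J i j = 0) /\
    (j = i.+1 :> nat -> J i j = 0 \/ J i j = 1 /\ J i i = J j j).

Lemma jordan_entries_cast (R : pzRingType) m n (e : m = n) (J : 'M[R]_m) :
  jordan_entries (castmx (e, e) J) <-> jordan_entries J.
Proof. by case: n / e; rewrite castmx_id. Qed.

Lemma jordan_entries_dsum (R : pzRingType) m n (A : 'M[R]_m) (B : 'M[R]_n) :
  jordan_entries (dsum_mx A B) <-> jordan_entries A /\ jordan_entries B.
Proof.
rewrite /dsum_mx; split=> [H | [HA HB] i j].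
  split=> i j.
    by have := H (lshift n i) (lshift n j); rewrite !block_mxEul.
  have := H (rshift m i) (rshift m j); rewrite !block_mxEdr /= !eqn_add2l.
  rewrite -addnS eqn_add2l => -[H1 H2]; split=> // e.
  by apply: H2; rewrite e.
case: (split_ordP i) => i' ->; case: (split_ordP j) => j' ->.
- by rewrite !block_mxEul; apply: HA.
- by rewrite block_mxEur mxE; split=> *; [|left].
- by rewrite block_mxEdl mxE; split=> *; [|left].
rewrite !block_mxEdr /= -addnS !eqn_add2l.
by have [H1 H2] := HB i' j'; split=> // /addnI.
Qed.

Lemma jordan_entries_block (R : pzRingType) s (a : R) :
  jordan_entries (jordan_block s a).
Proof.
move=> i j; rewrite !mxE !eqxx; split.
  move=> ji jSi; rewrite [i == j]eq_sym -(inj_eq val_inj) (negPf ji).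
  by rewrite [i.+1 == _]eq_sym (negPf jSi) addr0.
move=> e; right; have ij : (i == j) = false by rewrite -(inj_eq val_inj) /= e ltn_eqF.
by rewrite ij e eqxx !gtn_eqF // add0r !addr0.
Qed.

Lemma jordan_mx_cast (R : pzRingType) m n (e : m = n) (J : 'M[R]_m) :
  jordan_mx (castmx (e, e) J) <-> jordan_mx J.
Proof. by case: n / e; rewrite castmx_id. Qed.

Lemma jordan_mx_mxdiag (R : pzRingType) k (b : 'I_k -> nat * R) :
  (forall i, 0 < (b i).1)%N ->
  jordan_mx (\mxdiag_(i < k) jordan_block (b i).1 (b i).2).
Proof.
move=> b_gt0; exists k, (fun i => (b i).1), (fun i => (b i).2), erefl.
by rewrite castmx_id.
Qed.

Lemma mxdiag_dsum (R : pzRingType) k (p_ : 'I_k.+1 -> nat)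
    (B_ : forall i, 'M[R]_(p_ i)) :
  \mxdiag_i B_ i = castmx (mxsize_recl, mxsize_recl)
    (dsum_mx (B_ ord0) (\mxdiag_(i < k) B_ (lift ord0 i))).
Proof. by rewrite (@mxdiag_recl R). Qed.

Lemma jordan_mx_cons (R : pzRingType) s n (a : R) (J : 'M[R]_n) :
  (0 < s)%N -> jordan_mx J -> jordan_mx (dsum_mx (jordan_block s a) J).
Proof.
move=> s0 [k [t [b [e [t0 ->]]]]] {J}; case: n / e; rewrite castmx_id.
(* Sizes and eigenvalues are paired so that one equation between families
   rewrites both; rewriting the sizes alone would be ill-typed. *)
have [c [c0 cS c_gt0]] : exists c : 'I_k.+1 -> nat * R,
    [/\ c ord0 = (s, a), (fun i => c (lift ord0 i)) = (fun i => (t i, b i))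
      & forall i, (0 < (c i).1)%N].
  exists (fun i => if unlift ord0 i is Some j then (t j, b j) else (s, a)).
  split=> [||i]; first by rewrite unlift_none.
    by apply: boolp.funext => i; rewrite liftK.
  by case: (unlift _ _).
have subst_c x f : x = (s, a) -> f = (fun i => (t i, b i)) ->
    jordan_mx (dsum_mx (jordan_block x.1 x.2)
                 (\mxdiag_i jordan_block (f i).1 (f i).2)) ->
    jordan_mx (dsum_mx (jordan_block s a) (\mxdiag_i jordan_block (t i) (b i))).
  by move=> -> ->.
apply: (subst_c _ _ c0 cS).
have := jordan_mx_mxdiag c_gt0; rewrite mxdiag_dsum => /jordan_mx_cast; apply.
Qed.

Lemma mxdiag_jordan_entries (R : pzRingType) k (s : 'I_k -> nat) (a : 'I_k -> R) :
  jordan_entries (\mxdiag_(i < k) jordan_block (s i) (a i)).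
Proof.
elim: k => [|k IHk] in s a *; first by move=> [i hi]; exfalso; rewrite big_ord0 in hi.
rewrite mxdiag_dsum jordan_entries_cast jordan_entries_dsum.
by split; [exact: jordan_entries_block | exact: IHk].
Qed.

Lemma jordan_mx_entries (R : pzRingType) n (J : 'M[R]_n) :
  jordan_mx J -> jordan_entries J.
Proof.
case=> k [s [a [e [_ ->]]]]; rewrite jordan_entries_cast.
exact: mxdiag_jordan_entries.
Qed.

(** By strong induction: the first block ends at the first index whose
    superdiagonal entry vanishes, and the matrix splits there as a direct sum. *)
Lemma jordan_entries_mx (R : pzRingType) n (J : 'M[R]_n) :
  jordan_entries J -> jordan_mx J.
Proof.
elim/ltn_ind: n => n IHn in J *; move=> HJ.
have [n0|n_gt0] := posnP n.
  exists 0%N, (fun=> 0%N), (fun=> 0).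
  have e : (\sum_(i < 0) 0)%N = n by rewrite big_ord0.
  exists e; split=> [[]//|]; apply/matrixP=> [[i hi]]; exfalso.
  by move: hi; rewrite n0.
pose stop s := (0 < s <= n)%N &&
  [forall i : 'I_n, forall j : 'I_n,
     (i.+1 == s) && (j == s :> nat) ==> (J i j == 0)].
have ex_stop : exists s, stop s.
  exists n; rewrite /stop n_gt0 leqnn; apply/forallP=> i; apply/forallP=> j.
  by apply/implyP=> /andP[_ /eqP jn]; have := ltn_ord j; rewrite jn ltnn.
case: (ex_minnP ex_stop) => s /andP[/andP[s_gt0 s_le] /'forall_'forall_implyP Js] min_s.
have {}Js (i j : 'I_n) : i.+1 = s -> j = s :> nat -> J i j = 0.
  by move=> si sj; apply/eqP/Js; rewrite si sj !eqxx.
have J1 (i j : 'I_n) : (i.+1 < s)%N -> j = i.+1 :> nat ->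
    J i j = 1 /\ J i i = J j j.
  move=> i_lt ji; have [_ /(_ ji)[Jij|//]] := HJ i j.
  suff /min_s : stop i.+1 by rewrite leqNgt i_lt.
  rewrite /stop /= (leq_trans (ltnW i_lt) s_le).
  apply/'forall_'forall_implyP => i' j' /andP[/eqP[/val_inj->] /eqP].
  by rewrite -ji => /val_inj ->; rewrite Jij.
have en : (s + (n - s) = n)%N by rewrite subnKC.
move: (n - s)%N en => m en; move: {stop ex_stop min_s n_gt0 s_le}J HJ IHn Js J1.
case: n / en => J HJ IHn Js J1.
rewrite -[J]submxK.
have ur0 : ursubmx J = 0.
  apply/matrixP=> i j; rewrite !mxE.
  have [H0 _] := HJ (lshift m i) (rshift s j).
  have [ji|ji] := eqVneq (rshift s j : nat) (lshift m i).+1; last first.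
    by apply: H0 => //=; rewrite gtn_eqF // ltn_addr.
  have Si : i.+1 = s.
    by apply/eqP; rewrite eqn_leq ltn_ord -[i.+1]ji leq_addr.
  by apply: Js; rewrite ?ji /= Si.
have dl0 : dlsubmx J = 0.
  apply/matrixP=> i j; rewrite !mxE.
  have [H0 _] := HJ (rshift s i) (lshift m j).
  have lt_j : (j < s + i)%N by rewrite ltn_addr.
  by apply: H0; rewrite /= ltn_eqF // ltnW.
have HJdr : jordan_entries (drsubmx J).
  have := HJ; rewrite -{1}[J]submxK ur0 dl0 -/(dsum_mx _ _).
  by rewrite jordan_entries_dsum => -[].
rewrite ur0 dl0 -/(dsum_mx _ _).
pose i0 : 'I_s := Ordinal s_gt0.
suff -> : ulsubmx J = jordan_block s (J (lshift m i0) (lshift m i0)).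
  apply: jordan_mx_cons => //; apply: IHn => //.
  by rewrite -[X in (X < _)%N]add0n ltn_add2r.
have Jd (i : nat) (hi : (i < s)%N) (k := lshift m (Ordinal hi)) :
    J k k = J (lshift m i0) (lshift m i0).
  rewrite /k; elim: i => [|i IHi] in hi {k} *.
    by rewrite (_ : Ordinal hi = i0) //; apply: val_inj.
  rewrite -(IHi (ltnW hi)).
  by case: (J1 (lshift m (Ordinal (ltnW hi))) (lshift m (Ordinal hi))).
apply/matrixP=> i j; rewrite !mxE.
have [H0 _] := HJ (lshift m i) (lshift m j).
have [<-|ij] := eqVneq i j.
  by rewrite gtn_eqF // addr0 mulr1n; case: i {H0} => i hi; exact: Jd.
rewrite mulr0n add0r; have [/esym ji|ji] := eqVneq i.+1 j.
  by case: (J1 (lshift m i) (lshift m j)) => //=; rewrite -ji.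
by apply: H0; rewrite /= eq_sym.
Qed.

Lemma jordan_mxP (R : pzRingType) n (J : 'M[R]_n) :
  jordan_mx J <-> jordan_entries J.
Proof. by split; [exact: jordan_mx_entries | exact: jordan_entries_mx]. Qed.

(** The nilpotent part is upper triangular, so its diagonal consists of
    eigenvalues and vanishes; hence [D] is the whole diagonal of the Jordan
    matrix and [N] the whole superdiagonal.  This is what makes the splitting
    [D + N] of a Jordan matrix unique. *)
Lemma jordan_diagD (R : idomainType) n (D N : 'M[R]_n) :
  is_diag_mx D -> nilpotent_mx N -> jordan_entries (D + N) ->
  forall i j, N i j = 0 \/ j = i.+1 :> nat /\ N i j = 1 /\ D i i = D j j.
Proof.
move=> /is_diag_mxP D_diag [k Nk] HDN.
have up (i j : 'I_n) : (j < i)%N -> N i j = 0.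
  move=> lt_ji; have [H0 _] := HDN i j; move: H0.
  have Dij : D i j = 0 by apply: D_diag; rewrite gtn_eqF.
  by rewrite mxE Dij add0r; apply; rewrite ltn_eqF // ltnW.
have powN (m : nat) : (forall i j : 'I_n, (j < i)%N -> (N ^+ m) i j = 0) /\
    (forall i, (N ^+ m) i i = N i i ^+ m).
  elim: m => [|m [IH1 IH2]].
    rewrite expr0; split=> [i j lt_ji|i]; rewrite !mxE ?eqxx //.
    by rewrite -(inj_eq val_inj) gtn_eqF.
  rewrite exprS; split=> [i j lt_ji|i]; rewrite -[_ * _]/(_ *m _) mxE.
    apply: big1 => l _; have [li|il] := ltnP l i; first by rewrite up ?mul0r.
    by rewrite IH1 ?mulr0 // (leq_trans lt_ji).
  rewrite (bigD1 i) //= big1 ?addr0 ?IH2 ?exprS // => l li.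
  have [{}li|il|/val_inj/eqP] := ltngtP l i; last by rewrite (negPf li).
    by rewrite up ?mul0r.
  by rewrite IH1 ?mulr0.
have Nd i : N i i = 0.
  have [_ /(_ i)] := powN k; rewrite Nk mxE => /esym/eqP.
  by rewrite expf_eq0 => /andP[_ /eqP].
move=> i j; have [<-|ij] := eqVneq i j; first by left.
have [H0 H1] := HDN i j; rewrite !mxE !Nd !addr0 D_diag // add0r in H0 H1.
have [ji|ji] := eqVneq (j : nat) i.+1; last by left; apply: H0 => //; rewrite eq_sym.
by case: (H1 ji) => [->|[-> ->]]; [left | right].
Qed.

Lemma jordan_scale_diag (R : idomainType) n (c : R) (D N : 'M[R]_n) :
  is_diag_mx D -> nilpotent_mx N -> jordan_entries (D + N) ->
  jordan_entries (c *: D + N).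
Proof.
move=> D_diag N_nil HDN i j.
have Nij := jordan_diagD D_diag N_nil HDN.
have Nd k : N k k = 0 by case: (Nij k k) => [//|[/n_Sn]].
rewrite !mxE !Nd !addr0; move/is_diag_mxP: D_diag => D_diag; split=> [ji jSi|ji].
  rewrite D_diag 1?eq_sym // mulr0 add0r; case: (Nij i j) => [//|[]].
  by move/eqP; rewrite (negPf jSi).
rewrite D_diag ?ji ?ltn_eqF // mulr0 add0r.
by case: (Nij i j) => [->|[_ [-> ->]]]; [left|right].
Qed.

(** Conjugation by [diag (c ^ - i)] multiplies the superdiagonal by [c ^ -1] and
    fixes the diagonal. *)
Lemma jordan_scale_similar (F : fieldType) n (c : F) (D N : 'M[F]_n) :
  c != 0 -> is_diag_mx D -> nilpotent_mx N -> jordan_entries (D + N) ->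
  exists2 S : 'M[F]_n, S \in unitmx &
    (c *: (D + N)) *m S = S *m (c *: D + N).
Proof.
move=> c0 D_diag N_nil HDN.
have Nij := jordan_diagD D_diag N_nil HDN.
exists (diag_mx (\row_i c^-1 ^+ i)).
  rewrite unitmxE det_diag unitfE; apply/prodf_neq0 => i _.
  by rewrite mxE expf_neq0 // invr_neq0.
rewrite mul_mx_diag mul_diag_mx; apply/matrixP => i j; rewrite !mxE.
rewrite !mulrDr !mulrDl; congr (_ + _).
  have [<-|ij] := eqVneq i j; first by rewrite mulrC.
  by move/is_diag_mxP: D_diag => -> //; rewrite !(mulr0, mul0r).
case: (Nij i j) => [->|[-> [-> _]]]; first by rewrite !(mulr0, mul0r).
by rewrite !mulr1 exprS mulrA divff // mul1r.
Qed.

(** * Nonnegative matrices with constant row sums *)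

(** Any permutation listing the complement of the closed set [S] before [S]
    puts [A] in block triangular form. *)
Lemma reducible_mx_set (R : pzRingType) n (A : 'M[R]_n) (S : {set 'I_n}) :
  S != set0 -> S != setT ->
  (forall i j, i \in S -> j \notin S -> A i j = 0) -> reducible_mx A.
Proof.
move=> S0 ST AS.
pose t := enum (~: S) ++ enum S.
have t_uniq : uniq t.
  rewrite cat_uniq !enum_uniq andbT /=; apply/hasPn => i.
  by rewrite !mem_enum inE negbK.
have t_size : size t = n.
  by rewrite size_cat -!cardE addnC cardsC card_ord.
have t_lt (i : 'I_n) : (i < size t)%N by rewrite t_size.
pose f (i : 'I_n) := tnth (in_tuple t) (cast_ord (esym t_size) i).
have f_inj : injective f.
  move=> i j; rewrite /f !(tnth_nth i) /= => /eqP.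
  by rewrite nth_uniq // => /eqP/val_inj.
exists (perm f_inj), #|~: S|; split.
  apply/andP; split.
    by rewrite card_gt0; apply: contra ST => /eqP CS0; rewrite -[S]setCK CS0 setC0.
  rewrite -[X in (_ < X)%N]card_ord -cardsT proper_card // properEneq subsetT andbT.
  by apply: contra S0 => /eqP CST; rewrite -[S]setCK CST setCT.
have t_in (l : 'I_n) : (f l \in S) = (#|~: S| <= l)%N.
  rewrite /f (tnth_nth l) /= nth_cat -cardE; case: ltnP => lS.
    have := mem_nth l (s := enum (~: S)); rewrite -cardE => /(_ _ lS).
    by rewrite mem_enum inE => /negPf.
  have := mem_nth l (s := enum S) (n := l - #|~: S|); rewrite mem_enum; apply.
  by rewrite -cardE ltn_subLR // addnC cardsC card_ord.
move=> i j ki jk; rewrite tr_perm_mx -col_permE -row_permE !mxE !permE.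
by apply: AS; rewrite t_in // -ltnNge.
Qed.

(** Maximum principle: where [x] is maximal, it equals a weighted mean of its own
    values, so no positive weight goes to an index where it is smaller.  The
    set of maximal indices is thus closed, and irreducibility makes it full. *)
Lemma irreducible_eigenvector (R : realDomainType) n (A : 'M[R]_n.+1) (r : R)
    (x : 'cV[R]_n.+1) :
  irreducible_mx A -> (forall i j, 0 <= A i j) ->
  A *m const_mx 1 = r *: (const_mx 1 : 'cV_n.+1) -> A *m x = r *: x ->
  exists a, x = const_mx a.
Proof.
move=> A_irr A_ge0 A1 Ax.
have [i0 _ x_max] := @arg_maxP _ _ _ ord0 xpredT (fun i => x i 0) isT.
exists (x i0 0); have [ST|SnT] := eqVneq [set i | x i 0 == x i0 0] setT.
  apply/colP => i; rewrite mxE; apply/eqP.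
  by have : i \in [set i | x i 0 == x i0 0] by [rewrite ST inE]; rewrite inE.
exfalso; apply: A_irr; apply: (reducible_mx_set _ SnT).
  by apply/set0Pn; exists i0; rewrite inE.
move=> i j; rewrite !inE => /eqP xi xj.
have : \sum_l A i l * (x i 0 - x l 0) = 0.
  have /colP/(_ i) := Ax; have /colP/(_ i) := A1; rewrite !mxE mulr1.
  under eq_bigr do rewrite mxE mulr1; move=> Ai1 Aix.
  under eq_bigr do rewrite mulrBr.
  by rewrite sumrB Aix -mulr_suml Ai1 subrr.
have ge0 l : true -> 0 <= A i l * (x i 0 - x l 0).
  by move=> _; rewrite mulr_ge0 // subr_ge0 xi; exact: x_max.
move=> /eqP; rewrite (psumr_eq0 _ ge0) => /allP /(_ j (mem_index_enum _)) /=.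
by rewrite mulf_eq0 subr_eq0 xi [x i0 0 == _]eq_sym (negPf xj) orbF => /eqP.
Qed.

(** A left eigenvector is used because row sums bound the action of [A] on row
    vectors in the l1 norm: take absolute values and sum over the columns. *)
Lemma row_sum_spectral_bound (C : numDomainType) n (A : 'M[C]_n) (r mu : C)
    (z : 'rV[C]_n) :
  (forall i j, 0 <= A i j) -> A *m const_mx 1 = r *: (const_mx 1 : 'cV_n) ->
  z != 0 -> z *m A = mu *: z -> `|mu| <= r.
Proof.
move=> A_ge0 A1 z0 zA.
have z_gt0 : 0 < \sum_j `|z 0 j|.
  rewrite lt0r sumr_ge0 // andbT psumr_neq0 //.
  have [j zj] : exists j, z 0 j != 0 by apply/rV0Pn.
  by apply/hasP; exists j; rewrite ?mem_index_enum //= normr_gt0.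
rewrite -(ler_pM2r z_gt0) mulr_sumr.
apply: le_trans (_ : \sum_j \sum_i `|z 0 i| * A i j <= _).
  apply: ler_sum => j _; rewrite -normrM.
  have /rowP/(_ j) := zA; rewrite !mxE => <-.
  apply: le_trans (ler_norm_sum _ _ _) _; apply: ler_sum => i _.
  by rewrite normrM (ger0_norm (A_ge0 _ _)).
rewrite exchange_big mulr_sumr; apply: ler_sum => i _ /=.
have -> : r = \sum_j A i j.
  have /colP/(_ i) := A1; rewrite !mxE mulr1 => <-.
  by apply: eq_bigr => j _; rewrite mxE mulr1.
by rewrite -mulr_sumr mulrC.
Qed.

(** The real matrix [M] acts separately on real and imaginary parts. *)
Lemma irreducible_eigenvectorC (R : rcfType) n (M : 'M[R]_n.+1) (r : R)
    (x : 'cV[R[i]]_n.+1) :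
  irreducible_mx M -> (forall i j, 0 <= M i j) ->
  M *m const_mx 1 = r *: (const_mx 1 : 'cV_n.+1) ->
  map_mx (real_complex R) M *m x = r%:C *: x -> exists a, x = const_mx a.
Proof.
move=> M_irr M_ge0 M1 Mx.
have Re_mul (a : R) (z : R[i]) : complex.Re (a%:C * z) = a * complex.Re z.
  by case: z => u v /=; rewrite mul0r subr0.
have Im_mul (a : R) (z : R[i]) : complex.Im (a%:C * z) = a * complex.Im z.
  by case: z => u v /=; rewrite mul0r addr0.
have Mf (f : {additive R[i] -> R}) :
    (forall a z, f (a%:C * z) = a * f z) -> M *m map_mx f x = r *: map_mx f x.
  move=> f_mul; apply/colP => i; have /colP/(_ i) := Mx; rewrite !mxE.
  move=> /(congr1 f); rewrite f_mul raddf_sum => <-.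
  by apply: eq_bigr => j _; rewrite !mxE f_mul.
have [a xa] := irreducible_eigenvector M_irr M_ge0 M1 (Mf (@complex.Re R) Re_mul).
have [b xb] := irreducible_eigenvector M_irr M_ge0 M1 (Mf (@complex.Im R) Im_mul).
exists (a +i* b); apply/colP => i; move/colP/(_ i): xa; move/colP/(_ i): xb.
by rewrite !mxE; case: (x i 0) => u v /= -> ->.
Qed.

(** The first column of a Jordan basis of [M] lies in the eigenspace of [r], so it
    is a nonzero multiple of the all-ones vector.  [Y] consists of the other
    columns, rescaled so that the factor [c] reaches only the diagonal part. *)
Lemma perron_jordan_basis (R : rcfType) n (M : 'M[R]_n.+1) (r : R) (c : R[i])
    (D N : 'M[R[i]]_n) :
  irreducible_mx M -> (forall i j, 0 <= M i j) ->
  M *m const_mx 1 = r *: (const_mx 1 : 'cV_n.+1) ->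
  is_diag_mx D -> nilpotent_mx N -> c != 0 ->
  jordan_form_of (map_mx (real_complex R) M) (dsum_mx (r%:C%:M : 'M_1) (D + N)) ->
  exists Y : 'M[R[i]]_(n.+1, n),
    (row_mx (const_mx 1 : 'cV_n.+1) Y : 'M_n.+1) \in unitmx /\
    c *: (map_mx (real_complex R) M *m Y) = Y *m (c *: D + N).
Proof.
move=> M_irr M_ge0 M1 D_diag N_nil c0 [/jordan_mxP J_DN [P P_unit /(similarP P_unit) PM]].
have [_ DN] := (@jordan_entries_dsum _ 1 n _ _).1 J_DN.
have [S S_unit DNS] := jordan_scale_similar c0 D_diag N_nil DN.
pose Q : 'M_(n.+1, 1 + n) := invmx P; pose MC := map_mx (real_complex R) M.
have MQ : MC *m Q = Q *m dsum_mx (r%:C%:M : 'M_1) (D + N).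
  apply: (can_inj (mulKmx P_unit)); rewrite mulmxA PM.
  by rewrite -mulmxA mulmxV // mulmx1 mulKVmx.
have Q_unit : (Q : 'M_n.+1) \in unitmx by rewrite unitmx_inv.
move: MQ; rewrite -[Q in LHS]hsubmxK -[Q in RHS]hsubmxK mul_mx_row /dsum_mx mul_row_block.
rewrite !mulmx0 addr0 add0r mul_mx_scalar => /eq_row_mx[MQ0 MQ1].
have [a Q0] := irreducible_eigenvectorC M_irr M_ge0 M1 MQ0.
have a0 : a != 0.
  apply/eqP => a0; have : P *m lsubmx Q = lsubmx (1%:M : 'M_(1 + n)).
    by rewrite mulmx_lsub mulmxV.
  rewrite Q0 a0 => /matrixP/(_ 0 0); rewrite !mxE big1 => [|j _].
    by move/esym/eqP; rewrite pnatr_eq0 eqb0 => /negP; apply; apply/eqP/val_inj.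
  by rewrite mxE mulr0.
exists (rsubmx Q *m S); split; last first.
  by rewrite mulmxA MQ1 -!mulmxA -DNS -scalemxAl -scalemxAr.
have -> : row_mx (const_mx 1) (rsubmx Q *m S) =
    Q *m block_mx (a^-1%:M : 'M_1) 0 0 S :> 'M_(n.+1, 1 + n).
  rewrite -[Q in RHS]hsubmxK mul_row_block !mulmx0 addr0 add0r mul_mx_scalar Q0.
  by congr row_mx; apply/colP => i; rewrite !mxE mulVf.
rewrite (@unitmx_mul _ n.+1) Q_unit unitmxE (@det_lblock _ 1 n) det_scalar1.
by rewrite unitrM unitfE invr_eq0 a0 -unitmxE.
Qed.

(** [L] is the action of [c A] modulo the all-ones vector, so a left eigenvector of
    [L] extends by zero to a left eigenvector of [c A], whose eigenvalues are
    bounded by [c r]. *)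
Lemma deflated_unitmx (C : numFieldType) n (A : 'M[C]_n.+1) (r c mu : C)
    (Y : 'M[C]_(n.+1, n)) (L : 'M[C]_n) :
  (forall i j, 0 <= A i j) -> A *m const_mx 1 = r *: (const_mx 1 : 'cV_n.+1) ->
  (row_mx (const_mx 1 : 'cV_n.+1) Y : 'M_n.+1) \in unitmx ->
  0 <= c -> c *: (A *m Y) = Y *m L -> ~~ (`|mu| <= c * r) ->
  L - mu%:M \in unitmx.
Proof.
move=> A_ge0 A1; pose Q : 'M_(n.+1, 1 + n) := row_mx (const_mx 1 : 'cV_n.+1) Y.
rewrite -/Q => Q_unit c_ge0 AY mu_gt.
rewrite -row_free_unit; apply: inj_row_free => y.
rewrite mulmxBr mul_mx_scalar => /eqP; rewrite subr_eq0 => /eqP yL.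
pose w : 'rV_(1 + n) := row_mx 0 y.
have AQ : (c *: A) *m Q = Q *m (dsum_mx ((c * r)%:M : 'M_1) L).
  rewrite /Q mul_mx_row /dsum_mx mul_row_block !mulmx0 addr0 add0r mul_mx_scalar.
  by rewrite -!scalemxAl A1 scalerA AY.
have [|z0] := eqVneq (w *m invmx (Q : 'M_n.+1)) 0.
  move=> /(congr1 (mulmx^~ Q)); rewrite mulmxKV // mul0mx /w -[0 in RHS]row_mx0.
  by move=> /eq_row_mx[].
case/negP: mu_gt; apply: (@row_sum_spectral_bound _ _ (c *: A) _ _ _ _ _ z0).
- by move=> i j; rewrite mxE mulr_ge0.
- by rewrite -scalemxAl A1 scalerA.
rewrite -[LHS](mulmxK Q_unit) -(mulmxA _ _ Q) AQ mulmxA mulmxKV //.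
rewrite /w /dsum_mx mul_row_block !mulmx0 !mul0mx !add0r yL.
by rewrite scalemxAl scale_row_mx scaler0.
Qed.

(** The Sylvester equation that decouples the block [L] from the eigenvalue
    [c r + t s].  It is solvable even when that eigenvalue may be shared with
    [L], namely when [s = 0], since the coupling term then vanishes too. *)
Lemma splitting_row (C : numFieldType) n (A : 'M[C]_n.+1) (r c s t : C)
    (Y : 'M[C]_(n.+1, n)) (L : 'M[C]_n) (v : 'rV[C]_n) :
  (forall i j, 0 <= A i j) -> A *m const_mx 1 = r *: (const_mx 1 : 'cV_n.+1) ->
  (row_mx (const_mx 1 : 'cV_n.+1) Y : 'M_n.+1) \in unitmx ->
  0 <= c -> c *: (A *m Y) = Y *m L -> 0 <= r -> 0 <= s -> 0 < t ->
  exists u : 'rV_n, u *m L = (c * r + t * s) *: u + s *: v.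
Proof.
move=> A_ge0 A1 Q_unit c_ge0 AY r_ge0 s_ge0 t_gt0.
have [->|s0] := eqVneq s 0.
  by exists 0; rewrite mul0mx scaler0 scale0r addr0.
set l := c * r + t * s.
have U : L - l%:M \in unitmx.
  apply: (deflated_unitmx A_ge0 A1 Q_unit c_ge0 AY).
  have ts_gt0 : 0 < t * s by rewrite mulr_gt0 // lt0r s0.
  have l_ge0 : 0 <= l by rewrite addr_ge0 ?mulr_ge0 // ltW.
  by rewrite ger0_norm // gerDl lt_geF.
exists (s *: v *m invmx (L - l%:M)).
move: (_ *m invmx _) (mulmxKV U (s *: v)) => u <-.
by rewrite mulmxBr mul_mx_scalar [RHS]addrC subrK.
Qed.

(** * The basis of the tensor product *)

(** [rowsub (fun k => (mxtens_unindex k).2) V] is [1 (x) V]; writing it as a row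
    selection keeps its number of columns equal to that of [V], where a tensor
    product would give [1 * p]. *)
Lemma tensmx_mul_rowsub_snd (R : comPzRingType) m1 m n1 n p (A : 'M[R]_(m1, m))
    (B : 'M[R]_(n1, n)) (a : R) (V : 'M[R]_(n, p)) :
  A *m const_mx 1 = a *: (const_mx 1 : 'cV_m1) ->
  (A *t B) *m rowsub (fun k : 'I_(m * n) => (mxtens_unindex k).2) V =
  a *: rowsub (fun k : 'I_(m1 * n1) => (mxtens_unindex k).2) (B *m V).
Proof.
move=> A1; apply/matrixP => i j; rewrite !mxE.
have /colP/(_ (mxtens_unindex i).1) := A1; rewrite !mxE mulr1 => <-.
rewrite mulr_sum; apply: eq_bigr => k _.
by rewrite !mxE mulr1 mulrA.
Qed.

Lemma tensmx_mul_rowsub_fst (R : comPzRingType) m1 m n1 n p (A : 'M[R]_(m1, m))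
    (B : 'M[R]_(n1, n)) (b : R) (V : 'M[R]_(m, p)) :
  B *m const_mx 1 = b *: (const_mx 1 : 'cV_n1) ->
  (A *t B) *m rowsub (fun k : 'I_(m * n) => (mxtens_unindex k).1) V =
  b *: rowsub (fun k : 'I_(m1 * n1) => (mxtens_unindex k).1) (A *m V).
Proof.
move=> B1; apply/matrixP => i j; rewrite !mxE.
have /colP/(_ (mxtens_unindex i).2) := B1; rewrite !mxE mulr1 => <-.
rewrite mulrC mulr_sum; apply: eq_bigr => k _.
by rewrite !mxE mulr1 mulrAC.
Qed.

(** The columns [e_(i+1) - e_0], a basis of the vectors of coordinate sum zero. *)
Definition sum_zero_basis (R : pzRingType) n : 'M[R]_(n.+1, n) :=
  (col_mx (const_mx (-1) : 'rV_n) 1%:M : 'M_(1 + n, n)).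

Definition sum_zero_coord (R : pzRingType) n : 'M[R]_(n, n.+1) :=
  (row_mx (0 : 'cV_n) 1%:M : 'M_(n, 1 + n)).

Lemma sum_zero_basisK (R : pzRingType) n :
  sum_zero_coord R n *m sum_zero_basis R n = 1%:M.
Proof. by rewrite (@mul_row_col _ n 1 n n) mul0mx add0r mulmx1. Qed.

Lemma const_mul_sum_zero_basis (R : pzRingType) m n (a : R) :
  (const_mx a : 'M_(m, n.+1)) *m sum_zero_basis R n = 0.
Proof.
rewrite -[const_mx a](@row_mx_const _ m 1 n) (@mul_row_col _ m 1 n n) mulmx1.
by apply/matrixP => i j; rewrite !mxE big_ord1 !mxE mulrN1 addNr.
Qed.

Lemma const_mul_const (R : pzRingType) m n p :
  (const_mx 1 : 'M[R]_(m, n)) *m (const_mx 1 : 'M_(n, p)) = n%:R *: const_mx 1.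
Proof.
apply/matrixP => i j; rewrite !mxE mulr1.
under eq_bigr do rewrite !mxE mulr1.
by rewrite sumr_const card_ord.
Qed.

Lemma tens1mx1 (R : pzRingType) m n :
  (1%:M : 'M[R]_m) *t (1%:M : 'M[R]_n) = 1%:M.
Proof.
apply/matrixP => i j; rewrite !mxE -natrM mulnb.
by rewrite -(can_eq (@mxtens_unindexK m n)).
Qed.

Lemma rowsub0 (V : nmodType) m p q (f : 'I_m -> 'I_p) :
  rowsub f (0 : 'M[V]_(p, q)) = 0.
Proof. by apply/matrixP => i j; rewrite !mxE. Qed.

Section TensorBasis.
Variables (C : numFieldType) (n n' : nat).
Variables (Y : 'M[C]_(n.+1, n)) (Y' : 'M[C]_(n'.+1, n')).
Variables (u : 'rV[C]_n) (u' : 'rV[C]_n').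

Local Notation one m := (const_mx 1 : 'cV[C]_m).
Local Notation fst_ix := (fun k => (mxtens_unindex k).1).
Local Notation snd_ix := (fun k => (mxtens_unindex k).2).

(** The four groups of columns are [1 (x) 1], [1 (x) Y'] and [Y (x) 1] corrected
    along [1 (x) 1], and a basis of the kernel vectors. *)
Definition tensor_basis : 'M[C]_(n.+1 * n'.+1, 1 + (n' + (n + n * n'))) :=
  row_mx (one _)
    (row_mx (rowsub snd_ix Y' + one _ *m u')
       (row_mx (rowsub fst_ix Y + one _ *m u)
          (sum_zero_basis C n *t sum_zero_basis C n'))).

Lemma rowsub_one m p (f : 'I_m -> 'I_p) : rowsub f (one p) = one m.
Proof. by apply/matrixP => i j; rewrite !mxE. Qed.

Lemma rowsubZ m p q (f : 'I_m -> 'I_p) (a : C) (V : 'M_(p, q)) :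
  rowsub f (a *: V) = a *: rowsub f V.
Proof. by apply/matrixP => i j; rewrite !mxE. Qed.

Lemma mul_tensor_basis (M : 'M[C]_n.+1) (M' : 'M[C]_n'.+1) (r r' : C) 
    (L : 'M[C]_n) (L' : 'M[C]_n') (l := n.+1%:R * r' + n'.+1%:R * r) :
  M *m one _ = r *: one _ -> M' *m one _ = r' *: one _ ->
  n'.+1%:R *: (M *m Y) = Y *m L -> n.+1%:R *: (M' *m Y') = Y' *m L' ->
  u *m L = l *: u + r' *: (const_mx 1 *m Y) ->
  u' *m L' = l *: u' + r *: (const_mx 1 *m Y') ->
  (M *t const_mx 1 + const_mx 1 *t M') *m tensor_basis =
  tensor_basis *m dsum_mx (l%:M : 'M_1) (dsum_mx L' (dsum_mx L 0)).
Proof.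
move=> M1 M'1 MY M'Y' uL u'L'.
set A := _ *t _ + _.
have rowsub_ones m m1 p (f : 'I_m1 -> 'I_m) (V : 'M[C]_(m, p)) :
    rowsub f ((const_mx 1 : 'M_m) *m V) = one m1 *m (const_mx 1 *m V).
  rewrite -mul_rowsub_mx mulmxA; congr (_ *m _).
  by apply/matrixP => i j; rewrite !mxE big_ord1 !mxE mulr1.
have A1 : A *m one _ = l *: one _.
  rewrite -{1}(rowsub_one snd_ix) mulmxDl (tensmx_mul_rowsub_snd _ _ M1).
  rewrite (tensmx_mul_rowsub_snd _ _ (const_mul_const _ _ _ _)) M'1 const_mul_const.
  rewrite !rowsubZ rowsub_one !scalerA -scalerDl; congr (_ *: _).
  by rewrite /l [LHS]addrC (mulrC r).
have AY' : A *m rowsub snd_ix Y' =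
    rowsub snd_ix Y' *m L' + r *: (one _ *m (const_mx 1 *m Y')).
  rewrite mulmxDl (tensmx_mul_rowsub_snd _ _ M1).
  rewrite (tensmx_mul_rowsub_snd _ _ (const_mul_const _ _ _ _)).
  rewrite rowsub_ones addrC; congr (_ + _).
  by rewrite -rowsubZ M'Y' mul_rowsub_mx.
have AY : A *m rowsub fst_ix Y =
    rowsub fst_ix Y *m L + r' *: (one _ *m (const_mx 1 *m Y)).
  rewrite mulmxDl (tensmx_mul_rowsub_fst _ _ M'1).
  rewrite (tensmx_mul_rowsub_fst _ _ (const_mul_const _ _ _ _)).
  rewrite rowsub_ones; congr (_ + _).
  by rewrite -rowsubZ MY mul_rowsub_mx.
have AZ : A *m (sum_zero_basis C n *t sum_zero_basis C n') = 0.
  rewrite mulmxDl !tensmx_mul !const_mul_sum_zero_basis.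
  by rewrite tensmx0 tens0mx addr0.
rewrite /tensor_basis /dsum_mx !mul_mx_row !mul_row_block !mulmx0.
rewrite !addr0 !add0r mul_mx_scalar A1 AZ.
congr (row_mx _ (row_mx _ (row_mx _ _))).
  rewrite mulmxDr AY' (mulmxA A) A1 -scalemxAl mulmxDl -(mulmxA _ u') u'L'.
  by rewrite mulmxDr -!scalemxAr -addrA [in RHS](addrC (l *: _)).
rewrite mulmxDr AY (mulmxA A) A1 -scalemxAl mulmxDl -(mulmxA _ u) uL.
by rewrite mulmxDr -!scalemxAr -addrA [in RHS](addrC (l *: _)).
Qed.

Lemma ones_row_mx_inj m (Z : 'M[C]_(m.+1, m)) (a : 'cV[C]_1) (y : 'cV_m) :
  (row_mx (one m.+1) Z : 'M_m.+1) \in unitmx ->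
  one m.+1 *m a + Z *m y = 0 -> a = 0 /\ y = 0.
Proof.
move=> Z_unit; rewrite -mul_row_col.
move=> /(congr1 (mulmx (invmx (row_mx (one m.+1) Z : 'M_m.+1)))).
rewrite mulmx0 mulKmx // -[0 in RHS](@col_mx0 _ 1 m 1) => e.
by have [] := @eq_col_mx _ 1 m 1 _ _ _ _ e.
Qed.

(** [1^T (x) I] and [I (x) 1^T], which sum a tensor over one of its factors; the row
    selection only removes the spurious index of size one. *)
Definition sum_fst m p : 'M[C]_(p, m * p) :=
  rowsub (fun j => mxtens_index (ord0, j)) ((const_mx 1 : 'rV_m) *t 1%:M).

Definition sum_snd m p : 'M[C]_(m, m * p) :=
  rowsub (fun i => mxtens_index (i, ord0)) (1%:M *t (const_mx 1 : 'rV_p)).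

Lemma sum_fstE m p q (V : 'M[C]_(p, q)) (W : 'M[C]_(m, q)) :
  sum_fst m p *m rowsub snd_ix V = m%:R *: V /\
  sum_fst m p *m rowsub fst_ix W = one p *m (const_mx 1 *m W).
Proof.
rewrite /sum_fst !mul_rowsub_mx.
rewrite (tensmx_mul_rowsub_snd _ _ (const_mul_const _ _ _ _)) mul1mx.
rewrite (@tensmx_mul_rowsub_fst _ _ _ _ _ _ _ _ 1) ?mul1mx ?scale1r //.
split; apply/matrixP => i j; rewrite !mxE ?mxtens_indexK //.
by rewrite big_ord1 !mxE mul1r.
Qed.

Lemma sum_sndE m p q (V : 'M[C]_(p, q)) (W : 'M[C]_(m, q)) :
  sum_snd m p *m rowsub fst_ix W = p%:R *: W /\
  sum_snd m p *m rowsub snd_ix V = one m *m (const_mx 1 *m V).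
Proof.
rewrite /sum_snd !mul_rowsub_mx.
rewrite (tensmx_mul_rowsub_fst _ _ (const_mul_const _ _ _ _)) mul1mx.
rewrite (@tensmx_mul_rowsub_snd _ _ _ _ _ _ _ _ 1) ?mul1mx ?scale1r //.
split; apply/matrixP => i j; rewrite !mxE ?mxtens_indexK //.
by rewrite big_ord1 !mxE mul1r.
Qed.

Lemma sum_sum_zero_basis (Z := sum_zero_basis C n *t sum_zero_basis C n') :
  sum_fst n.+1 n'.+1 *m Z = 0 /\ sum_snd n.+1 n'.+1 *m Z = 0.
Proof.
rewrite /sum_fst /sum_snd !mul_rowsub_mx !tensmx_mul !const_mul_sum_zero_basis.
by rewrite tens0mx tensmx0; split; apply/matrixP => i j; rewrite !mxE.
Qed.

(** Summing over the first factor kills the last group and turns the relation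
    into one between [1] and [Y'], whence [y' = 0]; summing over the second gives
    [y = 0].  The coefficient of [1 (x) 1] then vanishes, and the last group is
    independent because it has a left inverse. *)
Lemma tensor_basis_inj (w : 'cV[C]_(1 + (n' + (n + n * n')))) :
  (row_mx (one n.+1) Y : 'M_n.+1) \in unitmx ->
  (row_mx (one n'.+1) Y' : 'M_n'.+1) \in unitmx ->
  tensor_basis *m w = 0 -> w = 0.
Proof.
move=> Y_unit Y'_unit.
rewrite -[w]vsubmxK -[dsubmx w]vsubmxK -[dsubmx (dsubmx w)]vsubmxK.
move: (usubmx w) (usubmx (dsubmx w)) => a y'.
move: (usubmx (dsubmx (dsubmx w))) (dsubmx (dsubmx (dsubmx w))) => y z.
rewrite /tensor_basis !mul_row_col !mulmxDl -!(mulmxA (one _)) !mul_rowsub_mx.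
set ZZ := _ *t _; move=> w0.
have [sumZ1 sumZ2] := sum_sum_zero_basis; rewrite -/ZZ in sumZ1 sumZ2.
(* [b] is the total coefficient of [1 (x) 1], corrections included. *)
have [b [bE b0]] : exists b, b = a + u' *m y' + u *m y /\
    one _ *m b + rowsub snd_ix (Y' *m y') + rowsub fst_ix (Y *m y) + ZZ *m z = 0.
  exists (a + u' *m y' + u *m y); split => //.
  by rewrite -[RHS]w0 !mulmxDr !addrA [LHS](ACl (1*4*2*5*3*6)).
have [b1 y'0] : n.+1%:R *: b + const_mx 1 *m (Y *m y) = 0 /\ y' = 0.
  have /(congr1 (mulmx (sum_fst _ _))) := b0.
  rewrite !mulmxDr !mulmxA sumZ1 mul0mx addr0 mulmx0.
  have [-> ->] := sum_fstE (Y' *m y') (Y *m y).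
  rewrite -(rowsub_one snd_ix) (sum_fstE (one _) (one n.+1)).1 -scalemxAl scalemxAr.
  rewrite addrAC -mulmxDr scalemxAr => /(ones_row_mx_inj Y'_unit)[b1 /eqP].
  by rewrite scaler_eq0 pnatr_eq0 -mulmxA => /eqP.
have y0 : y = 0.
  have /(congr1 (mulmx (sum_snd _ _))) := b0.
  rewrite !mulmxDr !mulmxA sumZ2 mul0mx addr0 mulmx0.
  have [-> ->] := sum_sndE (Y' *m y') (Y *m y).
  rewrite -(rowsub_one fst_ix) (sum_sndE (one n'.+1) (one _)).1 -scalemxAl scalemxAr.
  rewrite -mulmxDr scalemxAr => /(ones_row_mx_inj Y_unit)[_ /eqP].
  by rewrite scaler_eq0 pnatr_eq0 => /eqP.
rewrite y0 !mulmx0 addr0 in b1 *; move/eqP: b1.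
rewrite scaler_eq0 pnatr_eq0 /= => /eqP b_0.
have a0 : a = 0 by move: bE; rewrite b_0 y0 y'0 !mulmx0 !addr0.
have z0 : z = 0.
  move: b0; rewrite b_0 y'0 y0 !mulmx0 !rowsub0 !add0r.
  move=> /(congr1 (mulmx (sum_zero_coord C n *t sum_zero_coord C n'))).
  by rewrite mulmx0 mulmxA tensmx_mul !sum_zero_basisK tens1mx1 mul1mx.
by rewrite a0 y'0 z0 !col_mx0.
Qed.
End TensorBasis.

(** Only injectivity of [Q] is asked for, since [Q] is not literally square. *)
Lemma similar_in_cast (F : fieldType) m p (e : p = m) (A : 'M[F]_m)
    (T : 'M[F]_p) (Q : 'M[F]_(m, p)) :
  A *m Q = Q *m T -> (forall w : 'cV_p, Q *m w = 0 -> w = 0) ->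
  similar_in unitmx A (castmx (e, e) T).
Proof.
case: m / e in A Q *; rewrite castmx_id => AQ Q_inj.
have Q_unit : Q \in unitmx.
  rewrite -unitmx_tr -row_free_unit; apply: inj_row_free => v vQ.
  by apply: trmx_inj; rewrite trmx0; apply: Q_inj; apply: trmx_inj;
    rewrite trmx_mul trmxK trmx0.
exists (invmx Q); first by rewrite unitmx_inv.
apply/similarP; rewrite ?unitmx_inv //.
by rewrite -[LHS](mulmxK Q_unit) -(mulmxA _ A) AQ mulmxA mulVmx // mul1mx.
Qed.

(** * The Jordan form of the Kronecker sum *)

Theorem theorem2p5 (R : realType) (n n' : nat)
    (M : 'M[R]_n.+1) (M' : 'M[R]_n'.+1) (rho rho' : R)
    (D N : 'M[R[i]]_n) (D' N' : 'M[R[i]]_n')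
    (M_irr : irreducible_mx M) (M'_irr : irreducible_mx M')
    (M_ge0 : forall i j, 0 <= M i j) (M'_ge0 : forall i j, 0 <= M' i j)
    (M_one : M *m (const_mx 1 : 'cV[R]_n.+1) = rho *: const_mx 1)
    (M'_one : M' *m (const_mx 1 : 'cV[R]_n'.+1) = rho' *: const_mx 1)
    (D_diag : is_diag_mx D) (N_nil : nilpotent_mx N)
    (D'_diag : is_diag_mx D') (N'_nil : nilpotent_mx N')
    (JM : jordan_form_of (map_mx (real_complex R) M)
            (dsum_mx (rho%:C%:M : 'M_1) (D + N)))
    (JM' : jordan_form_of (map_mx (real_complex R) M')
            (dsum_mx (rho'%:C%:M : 'M_1) (D' + N'))) :
  jordan_form_of
    (map_mx (real_complex R)
       (M *t (const_mx 1 : 'M[R]_n'.+1) + (const_mx 1 : 'M[R]_n.+1) *t M'))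
    (castmx (tens_dim n n', tens_dim n n')
       (dsum_mx ((n.+1%:R * rho' + n'.+1%:R * rho)%:C%:M : 'M_1)
       (dsum_mx (n.+1%:R *: D' + N')
       (dsum_mx (n'.+1%:R *: D + N)
                (0 : 'M_(n * n')))))).
Proof.
have [/jordan_mxP jM _] := JM; have [/jordan_mxP jM' _] := JM'.
have [j1 jDN] := (@jordan_entries_dsum _ 1 n _ _).1 jM.
have [j1' jDN'] := (@jordan_entries_dsum _ 1 n' _ _).1 jM'.
split.
  apply/jordan_mx_cast/jordan_mxP; rewrite !jordan_entries_dsum.
  split; first by move=> i j; rewrite !ord1.
  by split; [|split]; [exact: jordan_scale_diag | exact: jordan_scale_diag |
    move=> i j; rewrite mxE; split=> *; [|left]].
have rowsumC m (A : 'M[R]_m.+1) (r : R) :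
    A *m (const_mx 1 : 'cV_m.+1) = r *: const_mx 1 ->
    map_mx (real_complex R) A *m const_mx 1 = r%:C *: (const_mx 1 : 'cV[R[i]]_m.+1).
  move=> A1; have := congr1 (map_mx (real_complex R)) A1.
  by rewrite map_mxM map_mxZ !map_const_mx rmorph1.
have ge0C m (A : 'M[R]_m.+1) : (forall i j, 0 <= A i j) ->
    forall i j, 0 <= map_mx (real_complex R) A i j.
  by move=> A_ge0 i j; rewrite mxE ler0c.
have radius_ge0 m (A : 'M[R]_m.+1) (r : R) : (forall i j, 0 <= A i j) ->
    A *m (const_mx 1 : 'cV_m.+1) = r *: const_mx 1 -> 0 <= r%:C :> R[i].
  move=> A_ge0 /colP/(_ ord0); rewrite !mxE mulr1 ler0c => <-.
  by apply: sumr_ge0 => i _; rewrite mxE mulr1.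
have nat0 m : m.+1%:R != 0 :> R[i] by rewrite pnatr_eq0.
have [Y [Y_unit MY]] :=
  perron_jordan_basis M_irr M_ge0 M_one D_diag N_nil (nat0 n') JM.
have [Y' [Y'_unit M'Y']] :=
  perron_jordan_basis M'_irr M'_ge0 M'_one D'_diag N'_nil (nat0 n) JM'.
have rho_ge0 := radius_ge0 _ _ _ M_ge0 M_one.
have rho'_ge0 := radius_ge0 _ _ _ M'_ge0 M'_one.
(* [u] and [u'] swap the roles of the two factors, whence the commuted sum in [uL]. *)
have [u uL] := splitting_row (const_mx 1 *m Y) (ge0C _ _ M_ge0)
  (rowsumC _ _ _ M_one)  Y_unit (ler0n _ n'.+1) MY rho_ge0 rho'_ge0 (ltr0Sn _ n).
have [u' u'L'] := splitting_row (const_mx 1 *m Y') (ge0C _ _ M'_ge0)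
  (rowsumC _ _ _ M'_one)  Y'_unit (ler0n _ n.+1) M'Y' rho'_ge0 rho_ge0 (ltr0Sn _ n').
rewrite (addrC (_ * rho%:C)) in uL.
apply: (@similar_in_cast _ _ _ _ _ _ (tensor_basis Y Y' u u')); last first.
  by move=> w; exact: tensor_basis_inj.
rewrite map_mxD !map_mxT !map_const_mx !rmorph1.
rewrite [_%:C]rmorphD !rmorphM !rmorph_nat.
exact: (mul_tensor_basis (rowsumC _ _ _ M_one) (rowsumC _ _ _ M'_one)
  MY M'Y' uL u'L').
Qed.
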